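(* A matrix $A \in M_{2n\times 2n}(\mathbb{C})$ is normal, Hamiltonian and symplectic diagonalizable if and only if $A = N - N^\star$ for some normal matrix $N \in M_{2n\times 2n}(\mathbb{C})$ satisfying $NN^\star = N^\star N = 0$.
   Context: $M_{2n\times 2n}(\mathbb{C})$ is the space of complex $2n\times 2n$ matrices and $A^H=\overline{A}^T$ is the Hermitian transpose. $A$ is normal if $A^HA=AA^H$. $J_{2n} = \begin{bmatrix} 0 & I_n \\ -I_n & 0\end{bmatrix}$. For $X \in M_{2n\times 2n}(\mathbb{C})$, $X^\star := J_{2n}^{-1}X^HJ_{2n} = J_{2n}^T X^H J_{2n}$ is the adjoint of $X$ with respect to the form $[x,y]=x^HJ_{2n}y$. $A$ is Hamiltonian if $A^\star=-A$. A matrix $S \in M_{2n\times 2n}(\mathbb{C})$ is symplectic if $S^H J_{2n} S = J_{2n}$. $A$ is symplectic diagonalizable if there is a symplectic matrix $S$ such that $S^{-1}AS$ is diagonal. *)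

(* Defs.v *)
From HB Require Import structures.
From mathcomp Require Import all_boot all_order all_algebra.
From mathcomp Require Import reals.
From mathcomp Require Import complex.
Set Implicit Arguments.
Unset Strict Implicit.
Unset Printing Implicit Defensive.
Import Order.TTheory GRing.Theory Num.Theory.
Local Open Scope ring_scope.
Local Open Scope sesquilinear_scope.

(* A 2n x 2n matrix is typed 'M_(n + n), so that J can be given by blocks. *)
Definition Jmx {C : numClosedFieldType} (n : nat) : 'M[C]_(n + n) :=
  block_mx 0 1%:M (- 1%:M) 0.

Definition staradj {C : numClosedFieldType} {n : nat} (X : 'M[C]_(n + n)) :
    'M[C]_(n + n) :=
  invmx (Jmx n) *m X ^t* *m Jmx n.

Definition hamiltonian {C : numClosedFieldType} {n : nat}
    (A : 'M[C]_(n + n)) : Prop :=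
  staradj A = - A.

(* Conjugate symplectic: the defining condition uses the conjugate transpose. *)
Definition symplectic {C : numClosedFieldType} {n : nat}
    (S : 'M[C]_(n + n)) : Prop :=
  S ^t* *m Jmx n *m S = Jmx n.

(* invmx S is a genuine inverse here, see symplectic_unitmx. *)
Definition symplectic_diagonalizable {C : numClosedFieldType} {n : nat}
    (A : 'M[C]_(n + n)) : Prop :=
  exists S : 'M[C]_(n + n), symplectic S /\ is_diag_mx (invmx S *m A *m S).

Lemma mul_trJmx {C : numClosedFieldType} n : (@Jmx C n)^T *m Jmx n = 1%:M.
Proof.
rewrite /Jmx tr_block_mx mulmx_block !trmx0 !trmx1.
rewrite (_ : (- 1%:M)^T = - 1%:M :> 'M[C]_n); last by rewrite linearN /= trmx1.
rewrite mulmxN mulNmx !mulmx0 !mul0mx !mulmx1 ?oppr0 ?opprK !addr0 !add0r.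
by rewrite scalar_mx_block.
Qed.

Lemma Jmx_unitmx {C : numClosedFieldType} n : @Jmx C n \in unitmx.
Proof. by have [] := mulmx1_unit (mul_trJmx (C := C) n). Qed.

Lemma invmx_Jmx {C : numClosedFieldType} n : invmx (@Jmx C n) = (Jmx n)^T.
Proof. by rewrite -[LHS]mul1mx -mul_trJmx mulmxK // Jmx_unitmx. Qed.

Lemma symplectic_unitmx {C : numClosedFieldType} n (S : 'M[C]_(n + n)) :
  symplectic S -> S \in unitmx.
Proof.
move=> hS; have := Jmx_unitmx (C := C) n.
by rewrite -hS unitmx_mul => /andP[].
Qed.

(* Main.v *)
Require Import Defs.
From HB Require Import structures.
From mathcomp Require Import all_boot all_order all_algebra.
From mathcomp Require Import reals.
From mathcomp Require Import complex.
Set Implicit Arguments.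
Unset Strict Implicit.
Unset Printing Implicit Defensive.
Import Order.TTheory GRing.Theory Num.Theory.
Local Open Scope ring_scope.
Local Open Scope sesquilinear_scope.

(* Both conditions say that A is Hamiltonian and A = U D U^H with D diagonal and
   U both unitary and symplectic.  For normal, symplectic diagonalizable A, with
   A S = S D, U is the unitary polar factor of S; taking N to be the part of A
   carried by the first n columns of U gives A = N - N^*.
   Conversely, N^* N = 0 says that the range of N is isotropic for J.  Such a
   subspace lies in a Lagrangian one, the range of some isometry V, and then
   N = V B V^H with B normal; diagonalizing B turns V into the first half of U. *)

(** * Conjugate transposes, Gram matrices and extension of isometries *)

Section ConjugateTranspose.
Context {C : numClosedFieldType}.

Lemma ctrmxM m n p (A : 'M[C]_(m, n)) (B : 'M[C]_(n, p)) :
  (A *m B)^t* = B^t* *m A^t*.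
Proof. by rewrite trmx_mul map_mxM. Qed.

Lemma ctrmxD m n (A B : 'M[C]_(m, n)) : (A + B)^t* = A^t* + B^t*.
Proof. by rewrite linearD map_mxD. Qed.

Lemma ctrmxN m n (A : 'M[C]_(m, n)) : (- A)^t* = - A^t*.
Proof. by rewrite linearN map_mxN. Qed.

Lemma ctrmxZ m n (a : C) (A : 'M[C]_(m, n)) : (a *: A)^t* = a^* *: A^t*.
Proof. by rewrite linearZ map_mxZ. Qed.

Lemma ctrmx1 n : (1%:M : 'M[C]_n)^t* = 1%:M.
Proof. by rewrite trmx1 map_mx1. Qed.

Lemma ctrmx0 m n : (0 : 'M[C]_(m, n))^t* = 0.
Proof. by rewrite trmx0 map_mx0. Qed.

Lemma ctr_diag_mx n (d : 'rV[C]_n) : (diag_mx d)^t* = diag_mx (map_mx Num.conj d).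
Proof. by rewrite tr_diag_mx map_diag_mx. Qed.

Lemma ctr_row_mx m n1 n2 (A : 'M[C]_(m, n1)) (B : 'M[C]_(m, n2)) :
  (row_mx A B)^t* = col_mx (A^t*) (B^t*).
Proof. by rewrite tr_row_mx map_col_mx. Qed.

Lemma ctr_block_mx m1 m2 n1 n2 (A : 'M[C]_(m1, n1)) (B : 'M[C]_(m1, n2))
    (A' : 'M[C]_(m2, n1)) (B' : 'M[C]_(m2, n2)) :
  (block_mx A B A' B')^t* = block_mx (A^t*) (A'^t*) (B^t*) (B'^t*).
Proof. by rewrite tr_block_mx map_block_mx. Qed.

(** Definiteness of the Hermitian form: the row space of [A] is orthogonal to itself. *)
Lemma mulmx_ctr_eq0 m n (A : 'M[C]_(m, n)) : A *m A^t* = 0 -> A = 0.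
Proof.
move=> /orthomx1P /orthomx_disj A0; apply/eqP; rewrite -submx0 -A0.
by rewrite sub_capmx !submx_refl.
Qed.

(** By normality, [X A^H] and [X A] have the same Gram matrix. *)
Lemma normalmx_mul_ctr_eq0 m n (A : 'M[C]_n) (X : 'M[C]_(m, n)) :
  A \is normalmx -> X *m A = 0 -> X *m A^t* = 0.
Proof.
move=> /normalmxP nA XA0; apply: mulmx_ctr_eq0.
by rewrite ctrmxM trmxCK !mulmxA -(mulmxA X) -nA mulmxA XA0 !mul0mx.
Qed.

(** Gram-Schmidt on a basis of the orthogonal complement of the rows of [E] supplies the missing
    rows. *)
Lemma unitarymx_completion k n (E : 'M[C]_(k, n)) : E \is unitarymx ->
  exists E' : 'M[C]_(n - k, n), col_mx E E' \is unitarymx.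
Proof.
move=> uE; have rE := mxrank_unitary uE.
set K := orthomx Num.conj (mx_of_hermitian (hermitian1mx _)) E.
have rK : \rank K = (n - k)%N by rewrite rank_ortho rE.
have uK : schmidt (row_base K) \is unitarymx by rewrite schmidt_unitarymx ?rank_leq_col.
have oK : (schmidt (row_base K) <= K)%MS.
  by rewrite eqmx_schmidt_free ?eq_row_base ?row_base_free.
move: (schmidt _) uK oK; rewrite rK => F uF oF; exists F.
have FE0 := orthomx1P oF.
apply/unitarymxP; rewrite tr_col_mx map_row_mx mul_col_row.
rewrite !(unitarymxP _) // FE0.
have -> : E *m F^t* = 0 by rewrite -[LHS]trmxCK ctrmxM trmxCK FE0 ctrmx0.
by rewrite -scalar_mx_block.
Qed.

(** Equal Gram matrices make the map from the rows of [X] to those of [Y] a well-defined isometry of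
    row spaces; orthonormal completions on both sides extend it to the whole space. *)
Lemma eq_gram_unitary m n (X Y : 'M[C]_(m, n)) : X *m X^t* = Y *m Y^t* ->
  exists2 T : 'M[C]_n, T \is unitarymx & Y = X *m T.
Proof.
move=> XY.
have gramM k (G : 'M_(k, m)) : G *m X *m (G *m X)^t* = G *m Y *m (G *m Y)^t*.
  by rewrite !ctrmxM !mulmxA -(mulmxA G X) -(mulmxA G Y) XY.
set E := schmidt (row_base X).
have uE : E \is unitarymx by rewrite schmidt_unitarymx ?rank_leq_col.
have eqE : (E :=: X)%MS.
  apply: eqmx_trans (eq_row_base X).
  exact/eqmx_schmidt_free/row_base_free.
have /submxP[G EG] : (E <= X)%MS by rewrite eqE.
have /submxP[H XH] : (X <= E)%MS by rewrite eqE.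
(* [F] applies to the rows of [Y] the combinations that turn those of [X] into the orthonormal basis
   [E]. *)
set F := G *m Y.
have uF : F \is unitarymx by apply/unitarymxP; rewrite -gramM -EG; apply/unitarymxP.
(* The Gram matrix of [(1 - H G) Y] equals that of [(1 - H G) X], which is zero. *)
have YH : Y = H *m F.
  apply/eqP; rewrite -subr_eq0 /F mulmxA -[Z in Z - _]mul1mx -mulmxBl.
  apply/eqP/mulmx_ctr_eq0; rewrite -gramM mulmxBl mul1mx -mulmxA -EG -XH.
  by rewrite subrr mul0mx.
have [E' uEE] := unitarymx_completion uE; have [F' uFF] := unitarymx_completion uF.
(* The completed families are therefore square, so their adjoints are two-sided inverses. *)
have dimE : (\rank X + (n - \rank X))%N = n by rewrite subnKC ?rank_leq_col.
have key (Z Z' : 'M[C]_(\rank X + (n - \rank X), n)) : Z \is unitarymx ->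
    Z' \is unitarymx -> Z^t* *m Z' \is unitarymx.
  move=> uZ uZ'; apply/unitarymxP; rewrite ctrmxM trmxCK mulmxA mulmxtVK //.
  by rewrite -[_ *m Z]mul1mx mulmxA mulmxKtV.
exists ((col_mx E E')^t* *m col_mx F F'); first exact: key.
transitivity (H *m E *m ((col_mx E E')^t* *m col_mx F F')); last by rewrite -XH.
rewrite YH -mulmxA; congr (H *m _).
have := unitarymxP uEE; rewrite tr_col_mx map_row_mx mul_col_row scalar_mx_block.
move=> /eq_block_mx[EE EE' _ _].
by rewrite mulmxA mul_mx_row EE EE' mul_row_col mul1mx mul0mx addr0.
Qed.

End ConjugateTranspose.

(** * The star adjoint, unitary symplectic matrices and Lagrangian subspaces *)

Section UnitarySymplectic.
Context {C : numClosedFieldType} {n : nat}.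
Local Notation J := (@Jmx C n).
Implicit Types (A N S U X : 'M[C]_(n + n)).

Lemma trmx_Jmx : J^T = - J.
Proof.
rewrite /Jmx tr_block_mx opp_block_mx !trmx0 trmx1 !oppr0.
by rewrite opprK linearN /= trmx1.
Qed.

Lemma ctrmx_Jmx : J^t* = - J.
Proof.
rewrite trmx_Jmx map_mxN; congr (- _).
by rewrite /Jmx map_block_mx !map_mx0 map_mxN map_mx1.
Qed.

Lemma mulmx_Jmx : J *m J = - 1%:M.
Proof. by rewrite -(mul_trJmx n) trmx_Jmx mulNmx opprK. Qed.

Lemma staradjE X : staradj X = - (J *m X^t* *m J).
Proof. by rewrite /staradj invmx_Jmx trmx_Jmx !mulNmx. Qed.

Lemma staradjK X : staradj (staradj X) = X.
Proof.
rewrite !staradjE ctrmxN !ctrmxM trmxCK ctrmx_Jmx !(mulmxN, mulNmx, opprK).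
by rewrite !mulmxA mulmx_Jmx -mulmxA mulmx_Jmx !(mulmxN, mulNmx, opprK) mulmx1 mul1mx.
Qed.

Lemma staradjB X Y : staradj (X - Y) = staradj X - staradj Y.
Proof. by rewrite !staradjE ctrmxD ctrmxN mulmxBr mulmxBl opprB opprK addrC. Qed.

Lemma staradj_block (a b c d : 'M[C]_n) :
  staradj (block_mx a b c d) = block_mx (d^t*) (- b^t*) (- c^t*) (a^t*).
Proof.
rewrite staradjE ctr_block_mx /Jmx !mulmx_block opp_block_mx.
by rewrite !(mulmx0, mul0mx, mulmxN, mulNmx, mulmx1, mul1mx, add0r, addr0, opprK).
Qed.

(** Since [U^H] inverts [U], preserving the form amounts to commuting with [J]; this makes
    similarity by [U] compatible with [staradj]. *)
Lemma symplectic_comm_Jmx U : U \is unitarymx -> symplectic U ->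
  J *m U = U *m J.
Proof.
move=> /unitarymxP uU sU.
by rewrite -[in RHS]sU !mulmxA uU mul1mx.
Qed.

Lemma staradj_conj U X : U \is unitarymx -> symplectic U ->
  staradj (U *m X *m U^t*) = U *m staradj X *m U^t*.
Proof.
move=> uU sU; have JU := symplectic_comm_Jmx uU sU.
have UJ : U^t* *m J = J *m U^t*.
  apply: oppr_inj; rewrite -mulmxN -mulNmx -ctrmx_Jmx -!ctrmxM.
  by rewrite JU.
by rewrite !staradjE !ctrmxM trmxCK !(mulmxN, mulNmx) !mulmxA JU -!mulmxA UJ.
Qed.

(** [J] is unitary, and [V^H J V = 0] makes the columns of [J V] orthogonal to those of [V]. The
    minus sign gives the upper right block of the transformed form the value [+1]. *)
Lemma lagrangian_symplectic (V : 'M[C]_(n + n, n)) :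
    V^t* *m V = 1%:M -> V^t* *m J *m V = 0 ->
  row_mx V (- J *m V) \is unitarymx /\ symplectic (row_mx V (- J *m V)).
Proof.
move=> VV VJV.
have VJ : (- J *m V)^t* = V^t* *m J by rewrite ctrmxM ctrmxN ctrmx_Jmx opprK.
have VJJ : V^t* *m J *m J = - V^t*.
  by rewrite -mulmxA mulmx_Jmx mulmxN mulmx1.
have sq : forall U, U^t* *m U = 1%:M -> U \is unitarymx.
  by move=> U UU; apply/unitarymxP/mulmx1C.
split.
  apply: sq; rewrite ctr_row_mx mul_col_row VV VJ VJV !mulmxA !(mulmxN, mulNmx).
  by rewrite VJV VJJ mulNmx VV oppr0 opprK -scalar_mx_block.
rewrite /symplectic ctr_row_mx mul_col_mx mul_col_row VJ VJV !mulmxA.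
by rewrite !(mulmxN, mulNmx) VJJ !(mulNmx, opprK) VV VJV.
Qed.

(* The rows of P and Q span the two eigenspaces of J (for eigenvalues of opposite
   sign), so equality of the Gram matrices of P N and Q N means Q N = T P N with
   T unitary, and the Lagrangian subspace is the graph of T. *)
Lemma lagrangian_of_isotropic N : N^t* *m J *m N = 0 ->
  exists V : 'M[C]_(n + n, n),
    [/\ V^t* *m V = 1%:M, V^t* *m J *m V = 0 & V *m V^t* *m N = N].
Proof.
move=> NJN.
set P : 'M[C]_(n, n + n) := row_mx 1%:M (- 'i%:M).
set Q : 'M[C]_(n, n + n) := row_mx 1%:M 'i%:M.
have ctri : ('i%:M : 'M[C]_n)^t* = - 'i%:M.
  by rewrite tr_scalar_mx map_scalar_mx /= conjCi rmorphN.
have ctrP : P^t* = col_mx 1%:M 'i%:M by rewrite ctr_row_mx ctrmxN ctri opprK ctrmx1.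
have ctrQ : Q^t* = col_mx 1%:M (- 'i%:M) by rewrite ctr_row_mx ctri ctrmx1.
have ii : ('i%:M : 'M[C]_n) *m 'i%:M = - 1%:M.
  by rewrite -scalar_mxM -expr2 sqrCi rmorphN.
have PP : P *m P^t* = 2%:R%:M.
  by rewrite ctrP mul_row_col mul1mx mulNmx ii opprK -raddfD.
have QQ : Q *m Q^t* = 2%:R%:M.
  by rewrite ctrQ mul_row_col mul1mx mulmxN ii opprK -raddfD.
have PQ : P *m Q^t* = 0.
  by rewrite ctrQ mul_row_col mul1mx mulmxN mulNmx ii !opprK subrr.
have QP : Q *m P^t* = 0.
  by rewrite ctrP mul_row_col mul1mx ii subrr.
have PQ1 : P^t* *m P + Q^t* *m Q = 2%:R%:M.
  rewrite ctrP ctrQ !mul_col_row add_block_mx !(mulmxN, mulNmx, mul1mx, mulmx1) ii.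
  by rewrite !opprK addrC subrr addNr -!raddfD -scalar_mx_block.
have PQJ : P^t* *m P - Q^t* *m Q = - ('i *+ 2) *: J.
  rewrite ctrP ctrQ !mul_col_row opp_block_mx add_block_mx.
  rewrite !(mulmxN, mulNmx, mul1mx, mulmx1) ii !opprK !subrr /Jmx scale_block_mx.
  rewrite !scaler0 scalerN scaleNr opprK !scale_scalar_mx mulr1.
  by congr block_mx; rewrite -?opprD -raddfD mulr2n.
have gramD k (X : 'M_(n + n, k)) :
    (P *m X)^t* *m (P *m X) + (Q *m X)^t* *m (Q *m X) = 2%:R *: (X^t* *m X).
  rewrite !ctrmxM !mulmxA -mulmxDl -!(mulmxA (X^t*)) -mulmxDr PQ1.
  by rewrite mul_mx_scalar -scalemxAl.
have gramB k (X : 'M_(n + n, k)) :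
    (P *m X)^t* *m (P *m X) - (Q *m X)^t* *m (Q *m X)
    = - ('i *+ 2) *: (X^t* *m J *m X).
  rewrite !ctrmxM !mulmxA -mulmxBl -!(mulmxA (X^t*)) -mulmxBr PQJ.
  by rewrite -scalemxAr -scalemxAl mulmxA.
(* [eq_gram_unitary] multiplies on the right, so it is applied to the adjoints of [P N] and [Q N];
   their Gram matrices agree by [gramB] and isotropy. *)
have [T TT QN] : exists2 T : 'M[C]_n, T^t* *m T = 1%:M & Q *m N = T *m (P *m N).
  have gramE : (P *m N)^t* *m (P *m N)^t*^t* = (Q *m N)^t* *m (Q *m N)^t*^t*.
    by rewrite !trmxCK; apply/eqP; rewrite -subr_eq0 gramB NJN scaler0.
  have [T uT QN] := eq_gram_unitary gramE; exists (T^t*).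
    by rewrite trmxCK; apply/unitarymxP.
  by rewrite -[LHS]trmxCK QN (ctrmxM _ T) trmxCK.
have n2 : 2%:R != 0 :> C by rewrite pnatr_eq0.
(* The graph of [T]: the factor 1/2 compensates [P P^H = Q Q^H = 2], so that [P V = 1] and
   [Q V = T]. *)
pose V := 2%:R^-1 *: (P^t* + Q^t* *m T).
have half m p (X : 'M[C]_(m, p)) : 2%:R^-1 *: (2%:R *: X) = X.
  by rewrite scalerA mulVf ?scale1r.
have PV : P *m V = 1%:M.
  rewrite -scalemxAr mulmxDr mulmxA PP PQ mul0mx addr0.
  by rewrite scale_scalar_mx mulVf.
have QV : Q *m V = T.
  by rewrite -scalemxAr mulmxDr mulmxA QP QQ add0r mul_scalar_mx half.
exists V; split.
- have := gramD _ V; rewrite PV QV ctrmx1 mul1mx TT => VV.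
  by rewrite -[LHS]half -VV -raddfD scale_scalar_mx mulVf.
- have /esym/eqP := gramB _ V; rewrite PV QV ctrmx1 mul1mx TT subrr scaler_eq0.
  by rewrite oppr_eq0 mulrn_eq0 (negPf (neq0Ci _)) /= => /eqP.
have VN : V^t* *m N = P *m N.
  rewrite ctrmxZ ctrmxD ctrmxM !trmxCK -scalemxAl mulmxDl -mulmxA QN.
  rewrite mulmxA TT mul1mx fmorphV rmorph_nat.
  by rewrite -mulr2n -scaler_nat half.
rewrite -mulmxA VN -scalemxAl mulmxDl -(mulmxA _ T) -QN !mulmxA -mulmxDl PQ1.
by rewrite mul_scalar_mx half.
Qed.

Lemma normal_isotropic_diag N : N \is normalmx -> staradj N *m N = 0 ->
  exists U (d : 'rV[C]_n), [/\ U \is unitarymx, symplectic U &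
    N = U *m block_mx (diag_mx d) 0 0 0 *m U^t*].
Proof.
move=> nN NN.
have NJN : N^t* *m J *m N = 0.
  have JX X : J *m X = 0 -> X = 0.
    by move=> JX0; rewrite -(mulKmx (Jmx_unitmx n) X) JX0 mulmx0.
  apply: JX; apply/eqP; rewrite !mulmxA -oppr_eq0 -mulNmx -staradjE; exact/eqP.
have [V0 [V0V0 V0JV0 V0N]] := lagrangian_of_isotropic NJN.
(* The projection [V0 V0^H] fixes [N] on the left; normality transfers this to [N^H], whose adjoint
   gives the right-hand version. *)
have NV0 : N *m (V0 *m V0^t*) = N.
  have /(normalmx_mul_ctr_eq0 nN) : (1%:M - V0 *m V0^t*) *m N = 0.
    by rewrite mulmxBl V0N mul1mx subrr.
  rewrite mulmxBl mul1mx => /eqP; rewrite subr_eq0 => /eqP NV0.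
  by rewrite -[RHS]trmxCK NV0 !ctrmxM !trmxCK.
pose B := V0^t* *m N *m V0.
have nB : B \is normalmx.
  apply/normalmxP; rewrite /B !ctrmxM trmxCK !mulmxA.
  rewrite -[in LHS](mulmxA _ V0) -[in LHS](mulmxA _ N) NV0.
  rewrite -[in RHS](mulmxA _ V0) -[in RHS](mulmxA _ _ N) V0N.
  by rewrite -!(mulmxA (V0^t*)) (normalmxP nN).
have /orthomx_spectralP := nB.
set W := spectralmx B; set d := spectral_diag B => BE.
have uW : W \is unitarymx := spectral_unitarymx B.
have WW : W *m W^t* = 1%:M by apply/unitarymxP.
(* An orthonormal eigenbasis of [B] replaces the basis [V0] of the same Lagrangian subspace. *)
pose V := V0 *m W^t*.
have [] := @lagrangian_symplectic V.
- by rewrite ctrmxM trmxCK !mulmxA -(mulmxA W) V0V0 mulmx1.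
- by rewrite ctrmxM trmxCK !mulmxA -!(mulmxA W) V0JV0 mul0mx mulmx0.
move=> uU sU; exists (row_mx V (- J *m V)), d; split => //.
rewrite ctr_row_mx mul_row_block !mulmx0 !addr0 mul_row_col mul0mx addr0.
rewrite ctrmxM trmxCK -{1}V0N -NV0.
transitivity (V0 *m B *m V0^t*); first by rewrite /B !mulmxA.
by rewrite BE invmx_unitary // !mulmxA.
Qed.

End UnitarySymplectic.

(** * Polar decomposition and intertwining of normal matrices *)

Section Polar.
Context {C : numClosedFieldType}.

(* With f the conjugation this is Fuglede's theorem, in diagonal form. *)
Lemma diag_mx_intertwine m n (a : 'rV[C]_m) (b : 'rV[C]_n) (f : C -> C)
    (X : 'M[C]_(m, n)) :
  diag_mx a *m X = X *m diag_mx b ->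
  diag_mx (map_mx f a) *m X = X *m diag_mx (map_mx f b).
Proof.
move=> /matrixP aXb; apply/matrixP => i j; have := aXb i j.
rewrite !mul_diag_mx !mul_mx_diag !mxE mulrC => /mulfI.
by have [->|X0 /(_ isT) ->] := eqVneq (X i j) 0; rewrite ?mulr0 ?mul0r // mulrC.
Qed.

(** [P] is the positive semidefinite square root of the Gram matrix, built on its eigenbasis; the
    last two clauses hold entrywise there. The last one, taken at [X = J], will make [P]
    symplectic. *)
Lemma gram_sqrt n (S : 'M[C]_n) : exists P : 'M[C]_n,
  [/\ P^t* = P, P *m P = S^t* *m S,
     forall X, X *m (S^t* *m S) = S^t* *m S *m X -> X *m P = P *m X &
     forall X, S^t* *m S *m X *m (S^t* *m S) = X -> P *m X *m P = X].
Proof.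
set M := S^t* *m S.
have nM : M \is normalmx by apply/normalmxP; rewrite /M ctrmxM trmxCK.
have /orthomx_spectralP := nM.
set W := spectralmx M; set m := spectral_diag M => ME.
have uW : W \is unitarymx := spectral_unitarymx M.
rewrite invmx_unitary // in ME.
have WW : W *m W^t* = 1%:M by apply/unitarymxP.
have WW' : W^t* *m W = 1%:M by apply: mulmx1C.
(* Each eigenvalue is the squared norm of a column of [S W^H]. *)
have m_ge0 i : 0 <= m 0 i.
  have : (S *m W^t*)^t* *m (S *m W^t*) = diag_mx m.
    rewrite ctrmxM trmxCK !mulmxA -(mulmxA W) -/M ME !mulmxA WW mul1mx.
    by rewrite -mulmxA WW mulmx1.
  move=> /matrixP/(_ i i); rewrite !mxE eqxx mulr1n => <-.
  by apply: sumr_ge0 => k _; rewrite !mxE mulrC mul_conjC_ge0.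
pose s := map_mx sqrtC m.
have s2 i : s 0 i * s 0 i = m 0 i by rewrite mxE -expr2 sqrtCK.
have conjW (Y Z : 'M[C]_n) : W *m Y *m W^t* = W *m Z *m W^t* -> Y = Z.
  move=> /(congr1 (fun X => W^t* *m X *m W)).
  by rewrite !mulmxA WW' !mul1mx -!mulmxA WW' !mulmx1.
have conjWM (Y Z : 'M[C]_n) : W *m (Y *m Z) *m W^t* = W *m Y *m W^t* *m (W *m Z *m W^t*).
  by rewrite !mulmxA -(mulmxA _ (W^t*) W) WW' mulmx1.
have conjWd (d : 'rV[C]_n) : W *m (W^t* *m diag_mx d *m W) *m W^t* = diag_mx d.
  by rewrite !mulmxA WW mul1mx -mulmxA WW mulmx1.
have conjWM2 : W *m M *m W^t* = diag_mx m by rewrite ME conjWd.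
have [P PE] : exists P, P = W^t* *m diag_mx s *m W by eexists.
have conjWP : W *m P *m W^t* = diag_mx s by rewrite PE conjWd.
exists P; split.
- rewrite PE !ctrmxM trmxCK ctr_diag_mx mulmxA; congr (_ *m diag_mx _ *m _).
  apply/rowP => i; rewrite !mxE; apply/CrealP/ger0_real.
  by rewrite sqrtC_ge0.
- apply: conjW; rewrite (conjWM P P) conjWP conjWM2; apply/matrixP => i j.
  rewrite mul_diag_mx [LHS]mxE [X in _ * X]mxE [RHS]mxE.
  by case: eqVneq => _; rewrite ?mulr0 // !mulr1n s2.
- move=> X XM; apply: conjW; rewrite (conjWM X P) (conjWM P X) conjWP.
  apply/esym/diag_mx_intertwine.
  by rewrite -conjWM2 -(conjWM M X) -(conjWM X M) XM.
(* Wherever the transformed [X] has a nonzero entry, [m_i m_j = 1]; nonnegativity then gives the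
   same for the square roots. *)
move=> X MXM; apply: conjW; rewrite (conjWM _ P) (conjWM P X) conjWP.
have : diag_mx m *m (W *m X *m W^t*) *m diag_mx m = W *m X *m W^t*.
  by rewrite -conjWM2 -(conjWM M X) -(conjWM _ M) MXM.
move: (W *m X *m W^t*) => Y /matrixP mYm; apply/matrixP => i j.
have := mYm i j; rewrite !mul_diag_mx !mul_mx_diag !mxE.
have [->|Y0] := eqVneq (Y i j) 0; first by rewrite !mulr0 !mul0r.
move=> mYmij; have mm1 : m 0 i * m 0 j = 1.
  by apply: (mulIf Y0); rewrite mul1r mulrAC.
by rewrite mulrAC -sqrtCM ?nnegrE // mm1 sqrtC1 mul1r.
Qed.

(** Unitary diagonalization of [A] reduces this to two diagonal matrices intertwined by [B S], whose
    entries can be conjugated. *)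
Lemma normal_intertwine_ctr m n (A : 'M[C]_m) (S : 'M[C]_(m, n)) (d : 'rV[C]_n) :
  A \is normalmx -> A *m S = S *m diag_mx d -> A^t* *m S = S *m (diag_mx d)^t*.
Proof.
move=> /orthomx_spectralP.
set B := spectralmx A; set a := spectral_diag A => AE ASD.
have uB : B \is unitarymx := spectral_unitarymx A.
rewrite invmx_unitary // in AE.
have BB : B *m B^t* = 1%:M by apply/unitarymxP.
have BB' : B^t* *m B = 1%:M by apply: mulmx1C.
have /(diag_mx_intertwine Num.conj) : diag_mx a *m (B *m S) = B *m S *m diag_mx d.
  by rewrite -(mulmxA B) -ASD AE !mulmxA BB mul1mx.
rewrite -!ctr_diag_mx => BS.
rewrite AE !ctrmxM trmxCK -!mulmxA BS !mulmxA.
by rewrite BB' mul1mx.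
Qed.

(* Polar decomposition: both factors of S = U P are symplectic, and D commutes
   with P^2 = S^H S because A^H S = S D^H. *)
Lemma normal_symplectic_diag n (A : 'M[C]_(n + n)) :
  A \is normalmx -> symplectic_diagonalizable A ->
  exists U (d : 'rV[C]_(n + n)), [/\ U \is unitarymx, symplectic U &
    A = U *m diag_mx d *m U^t*].
Proof.
move=> nA [S [sS /is_diag_mxP]].
have unS := symplectic_unitmx sS.
move=> diagD.
have [d dE] : exists d : 'rV[C]_(n + n), invmx S *m A *m S = diag_mx d.
  exists (\row_i (invmx S *m A *m S) i i); apply/matrixP => i j.
  rewrite [RHS]mxE [X in _ = X *+ _]mxE; have [<-|ij] := eqVneq i j; first by rewrite mulr1n.
  by rewrite diagD.
have AS : A *m S = S *m diag_mx d by rewrite -dE -mulmxA mulKVmx.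
have AS' := normal_intertwine_ctr nA AS.
have [P [Pherm PP Pcomm Pconj]] := gram_sqrt S.
(* The adjoint of [AS'] is [S^H A = D S^H], so both sides equal [S^H A S]. *)
have DM : diag_mx d *m (S^t* *m S) = S^t* *m S *m diag_mx d.
  have := congr1 (fun X => X^t*) AS'; rewrite !ctrmxM !trmxCK => SA.
  by rewrite mulmxA -SA -mulmxA AS mulmxA.
have DP := Pcomm _ DM.
have unM : S^t* *m S \in unitmx.
  by rewrite unitmx_mul unS andbT map_unitmx unitmx_tr unS.
have unP : P \in unitmx by move: unM; rewrite -PP unitmx_mul => /andP[].
have PJP : P *m Jmx n *m P = Jmx n.
  apply: Pconj.
  (* [S^H] is symplectic too: the left inverse [- J S^H J] of [S] is also a right inverse. *)
  have SJS : S *m Jmx n *m S^t* = Jmx n.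
    have : S *m (- (Jmx n *m S^t* *m Jmx n)) = 1%:M.
      by apply: mulmx1C; rewrite mulNmx -!mulmxA (mulmxA (S^t*)) sS mulmx_Jmx opprK.
    move=> /(congr1 (mulmx^~ (Jmx n))); rewrite mul1mx mulmxN mulNmx -!mulmxA.
    by rewrite mulmx_Jmx !mulmxN opprK mulmx1 mulmxA.
  rewrite !mulmxA -(mulmxA _ S) -(mulmxA _ _ (S^t*)) SJS.
  exact: sS.
have ctrV : (invmx P)^t* = invmx P.
  by rewrite trmx_inv map_invmx Pherm.
have uU : S *m invmx P \is unitarymx.
  apply/unitarymxP/mulmx1C.
  rewrite ctrmxM ctrV mulmxA -(mulmxA _ _ S) -PP mulmxA mulVmx // mul1mx.
  by rewrite mulmxV.
exists (S *m invmx P), d; split=> //.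
  rewrite /symplectic ctrmxM ctrV !mulmxA -2!(mulmxA (invmx P)) sS.
  by rewrite -{1}PJP !mulmxA mulVmx // mul1mx mulmxK.
have DV : diag_mx d *m invmx P = invmx P *m diag_mx d.
  by rewrite -[LHS](mulKmx unP) (mulmxA P) -DP mulmxK.
rewrite -(mulmxA S) -DV !mulmxA -AS -!mulmxA (mulmxA S).
by rewrite (unitarymxP uU) mulmx1.
Qed.

End Polar.

(** * Splitting the spectrum into two halves, and the equivalence *)

Lemma diag_mx_hsubmx {C : numClosedFieldType} n (d : 'rV[C]_(n + n)) :
  diag_mx d = block_mx (diag_mx (lsubmx d)) 0 0 (diag_mx (rsubmx d)).
Proof. by rewrite -{1}(hsubmxK d) diag_mx_row. Qed.

Theorem theorem4 (R : realType) (n : nat) (A : 'M[R[i]]_(n + n)) :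
  (A \is normalmx /\ hamiltonian A /\ symplectic_diagonalizable A) <->
  exists N : 'M[R[i]]_(n + n),
    [/\ N \is normalmx, N *m staradj N = 0, staradj N *m N = 0
      & A = N - staradj N].
Proof.
have normal_conj (U X : 'M[R[i]]_(n + n)) (d : 'rV_(n + n)) :
    U \is unitarymx -> U *m diag_mx d *m U^t* \is normalmx.
  move=> uU; apply/orthomx_spectral_subproof; exists (U^t*, d) => /=.
    by rewrite trmxC_unitary.
  by rewrite invmx_unitary ?trmxC_unitary // trmxCK.
split.
  move=> [nA [hA sdA]]; have [U [d [uU sU AE]]] := normal_symplectic_diag nA sdA.
  have UU : U^t* *m U = 1%:M by apply/mulmx1C/unitarymxP.
  pose a := diag_mx (lsubmx d).
  have starD : staradj (diag_mx d) = - diag_mx d.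
    have := hA; rewrite /hamiltonian AE staradj_conj // -mulNmx -mulmxN.
    move: (staradj _) => E /(congr1 (fun X => U^t* *m X *m U)).
    by rewrite !mulmxA UU !mul1mx -!mulmxA UU !mulmx1.
  (* The lower right blocks of [starD] force the second half of the spectrum to be minus the
     conjugate of the first. *)
  have DE : diag_mx d = block_mx a 0 0 (- a^t*).
    have := starD; rewrite !diag_mx_hsubmx staradj_block opp_block_mx.
    by move=> /eq_block_mx[_ _ _ ->]; rewrite opprK.
  (* [N] keeps the first half of the spectrum; its star sits on the complementary diagonal block, so
     both products vanish. *)
  pose N := U *m block_mx a 0 0 0 *m U^t*.
  have NE : staradj N = U *m block_mx 0 0 0 (a^t*) *m U^t*.
    by rewrite staradj_conj // staradj_block !ctrmx0 oppr0.
  have mulU (X Y : 'M_(n + n)) : U *m X *m U^t* *m (U *m Y *m U^t*) = U *m (X *m Y) *m U^t*.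
    by rewrite !mulmxA -(mulmxA _ (U^t*) U) UU mulmx1.
  exists N; split.
  - rewrite /N (_ : block_mx _ _ _ _ = diag_mx (row_mx (lsubmx d) 0)); last first.
      by rewrite diag_mx_row linear0.
    exact: normal_conj.
  - by rewrite NE mulU mulmx_block !(mulmx0, mul0mx, addr0) block_mx0 mulmx0 mul0mx.
  - by rewrite NE mulU mulmx_block !(mulmx0, mul0mx, addr0) block_mx0 mulmx0 mul0mx.
  rewrite NE -mulmxBl -mulmxBr opp_block_mx add_block_mx !oppr0 !add0r !addr0.
  by rewrite -DE.
move=> [N [nN _ NN AE]].
have [U [d [uU sU NE]]] := normal_isotropic_diag nN NN.
have hA : hamiltonian A by rewrite /hamiltonian AE staradjB staradjK opprB.
(* The star moves [d] to the second block as its conjugate, so the same [U] diagonalizes [N] and its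
   star at once. *)
have {}AE : A = U *m diag_mx (row_mx d (- map_mx Num.conj d)) *m U^t*.
  rewrite AE NE staradj_conj // -mulmxBl -mulmxBr staradj_block.
  rewrite opp_block_mx add_block_mx !ctrmx0 !oppr0 !add0r !addr0 diag_mx_row.
  by rewrite ctr_diag_mx linearN.
split; [by rewrite AE; exact: normal_conj | split=> //].
exists U; split => //.
rewrite AE invmx_unitary // !mulmxA (mulmx1C (unitarymxP uU)) mul1mx.
rewrite -mulmxA (mulmx1C (unitarymxP uU)) mulmx1.
exact: diag_mx_is_diag.
Qed.
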